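(* Let $r\ge 1$ be an integer. The ordered $r$-Bell numbers $b(n,r)$ satisfy the recurrence $$b(n,r)=r^{n-1}+\sum_{i=1}^{n-1}\binom{n}{i}r^{i-1}\,b(n-i,r)\qquad\text{for all } n\ge 2,$$ with the initial condition $b(1,r)=1$.
   Context: For integers $n\ge 1$ and $r\ge 1$, the ordered $r$-Bell number is $$b(n,r):=\sum_{\substack{N_1,\ldots,N_r\in\mathbb{Z}_{\ge 0}\\ \sum_j N_j>0}}S\Big(n,\sum_{j=1}^r jN_j\Big)\Big(\sum_{j=1}^r jN_j\Big)!\,\binom{\sum_{j=1}^r N_j}{N_1,\ldots,N_r}\left(\frac1r\right)^{\sum_{j=1}^r N_j}\prod_{j=1}^r\binom{r}{j}^{N_j},$$ where $S(n,k)$ is the Stirling number of the second kind (the number of partitions of an $n$-element set into exactly $k$ nonempty blocks, so $S(n,k)=0$ for $k>n$ and the sum is finite), and $\binom{N}{N_1,\ldots,N_r}=\frac{N!}{N_1!\cdots N_r!}$ is the multinomial coefficient. *)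

(* Defs.v *)
From mathcomp Require Import all_boot all_order all_algebra.
Set Implicit Arguments.
Unset Strict Implicit.
Unset Printing Implicit Defensive.
Import Order.TTheory GRing.Theory Num.Theory.
Local Open Scope ring_scope.

Definition stirling2 (n k : nat) : nat :=
  #|[set P : {set {set 'I_n}} | partition P [set: 'I_n] && (#|P| == k)%N]|.

Definition multinomial (r : nat) (N : 'I_r -> nat) : rat :=
  ((\sum_(j < r) N j)%N)`!%:R / \prod_(j < r) (N j)`!%:R.

(* Ordinals start at 0, so j : 'I_r stands for the index j.+1 in {1, ..., r}. *)
Definition weight (r : nat) (N : 'I_r -> nat) : nat :=
  (\sum_(j < r) j.+1 * N j)%N.

Definition bell_term (n r : nat) (N : 'I_r -> nat) : rat :=
  (stirling2 n (weight N))%:R * (weight N)`!%:R * multinomial N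
  * (1 / r%:R) ^+ (\sum_(j < r) N j)%N
  * \prod_(j < r) 'C(r, j.+1)%:R ^+ N j.

(* The sum over all tuples of natural numbers is cut down to the tuples with
   entries at most n; by bell_term_eq0 below all other terms vanish. *)
Definition ordered_bell (n r : nat) : rat :=
  \sum_(N : {ffun 'I_r -> 'I_n.+1} | (0 < \sum_(j < r) N j)%N)
    bell_term n (fun j => N j : nat).

Lemma stirling2_gt (n k : nat) : (n < k)%N -> stirling2 n k = 0%N.
Proof.
move=> lt_nk; apply/eqP; rewrite cards_eq0 -subset0; apply/subsetP => P.
rewrite !inE => /andP[partP /eqP cardP].
suff : (#|P| <= n)%N by rewrite cardP leqNgt lt_nk.
rewrite -[leqRHS]card_ord -cardsT (card_partition partP) -sum1_card.
apply: leq_sum => A PA; rewrite card_gt0.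
by case/and3P: partP => _ _; apply: contraNneq => <-.
Qed.

Lemma bell_term_eq0 (n r : nat) (N : 'I_r -> nat) (j : 'I_r) :
  (n < N j)%N -> bell_term n N = 0.
Proof.
move=> lt_nN; rewrite /bell_term stirling2_gt ?mul0r //.
apply: leq_trans lt_nN _; rewrite /weight (bigD1 j) //=.
by apply: leq_trans (leq_addr _ _); rewrite leq_pmull.
Qed.

(* Main.v *)
(* Put P(x) = ((1 + x)^r - 1) / r and let L_n be the linear form on polynomials
   with L_n(x^k) = k! S(n, k), so that L_n(p) = n! [z^n] p(e^z - 1). Sorting
   maps by their fibres gives L_n((1 + x)^k) = k^n, so the binomial theorem
   yields the Leibniz rule L_n(p q) = sum_i C(n, i) L_i(p) L_{n-i}(q). By the
   multinomial theorem b(n, r) is the sum of L_n(P^m) over m >= 1, and since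
   L_i(P) = r^(i-1) for i >= 1, applying the Leibniz rule to P P^m gives the
   recurrence. Only 1 <= m <= n contributes, because x^m divides P^m. *)
Require Import Defs.
From HB Require Import structures.
From mathcomp Require Import all_boot all_order all_algebra.
From mathcomp Require Import ring.
Import Order.TTheory GRing.Theory Num.Theory.
Local Open Scope ring_scope.

(** * Fibres of maps and Stirling numbers *)

Lemma preim_partition_eqP (T : finType) (U : eqType) (f : T -> U)
    (P : {set {set T}}) : partition P setT ->
  reflect (forall x y, (f x == f y) = (y \in pblock P x))
          (preim_partition f setT == P).
Proof.
move=> partP; apply: (iffP eqP) => [<- x y | eq_f].
  rewrite pblock_equivalence_partition ?in_setT // => a b c _ _ _; split=> //.
  by move/eqP->.
rewrite -[RHS](equivalence_partition_pblock partP) /preim_partition.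
rewrite /equivalence_partition; apply: eq_imset => x.
by apply/setP=> y; rewrite !inE eq_f.
Qed.

(** Such an [f] is constant on each block and separates distinct blocks, so it amounts to an
    injection from the set of blocks into [U]. *)
Lemma card_preim_partition (T U : finType) (P : {set {set T}}) :
  partition P setT ->
  #|[set f : {ffun T -> U} | preim_partition f setT == P]| = (#|U| ^_ #|P|)%N.
Proof.
move=> partP; have /and3P[_ trivP P0] := partP.
have PB x : pblock P x \in P.
  by apply: pblock_mem; rewrite (cover_partition partP) inE.
pose B x : {A | A \in P} := Sub (pblock P x) (PB x).
have Bsurj (A : {A | A \in P}) : exists x, B x = A.
  have /set0Pn[x Ax] : val A != set0 by apply: contraNneq P0 => <-; apply: valP.
  by exists x; apply/val_inj/def_pblock => //; apply: valP.
have eqB x y : (B x == B y) = (y \in pblock P x).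
  rewrite -(inj_eq val_inj) /= eq_pblock //.
  by rewrite (cover_partition partP) inE.
pose h (g : {ffun {A | A \in P} -> U}) := [ffun x => g (B x)].
have h_inj : injective h.
  move=> g g' /ffunP eqh; apply/ffunP => A; have [x <-] := Bsurj A.
  by have := eqh x; rewrite !ffunE.
have -> : #|P| = #|{: {A | A \in P}}| by rewrite card_sig; apply: eq_card.
rewrite -card_inj_ffuns -(card_imset _ h_inj); apply/esym/eq_card => f.
rewrite inE; apply/imsetP/(preim_partition_eqP _ _ _ _ partP)
  => [[g] | eq_f].
  by rewrite inE => /injectiveP ginj -> x y; rewrite !ffunE (inj_eq ginj) eqB.
(* [c] picks a representative of each block, at which [f] is read off. *)
have /fin_all_exists[c BK] := Bsurj; exists [ffun A => f (c A)].
  rewrite inE; apply/injectiveP => A A'; rewrite !ffunE => /eqP.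
  by rewrite eq_f -eqB !BK => /eqP.
by apply/ffunP => x; rewrite !ffunE; apply/eqP; rewrite eq_f -eqB BK.
Qed.

(** Maps from ['I_n] to ['I_k] are sorted by their partition into fibres, and the partitions by
    their number of blocks. *)
Lemma expn_stirling2 (k n : nat) :
  (k ^ n = \sum_(j < n.+1) stirling2 n j * k ^_ j)%N.
Proof.
have size_part (P : {set {set 'I_n}}) : partition P setT -> (#|P| < n.+1)%N.
  move=> partP; rewrite ltnS leqNgt; apply/negP => /stirling2_gt/eqP.
  rewrite cards_eq0 => /eqP/setP/(_ P).
  by rewrite !inE partP eqxx.
have -> : (k ^ n = #|{ffun 'I_n -> 'I_k}|)%N by rewrite card_ffun !card_ord.
rewrite -sum1_card (partition_big
  (fun f : {ffun 'I_n -> 'I_k} => preim_partition f setT)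
  (fun P => partition P [set: 'I_n])) /=; last first.
  by move=> f _; apply: preim_partitionP.
under eq_bigr => P partP.
  rewrite sum1dep_card card_preim_partition // card_ord; over.
rewrite (partition_big
  (fun P : {set {set 'I_n}} => inord #|P| : 'I_n.+1) xpredT) //=.
apply: eq_bigr => j _; rewrite /stirling2 -sum1dep_card big_distrl /=.
apply: eq_big => [P | P /andP[partP /eqP <-]].
  by apply: andb_id2l => partP; rewrite -val_eqE /= inordK ?size_part.
by rewrite mul1n inordK ?size_part.
Qed.

(** * The linear form L_n and its Leibniz rule *)

(* The form L_n of the header. *)
Definition umbral (n : nat) (p : {poly rat}) : rat :=
  \sum_(k < n.+1) p`_k * (stirling2 n k * k`!)%:R.

Lemma umbral_is_scalar n : scalar (umbral n).
Proof.
move=> a p q; rewrite /umbral mulr_sumr -big_split /=.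
by apply: eq_bigr => k _; rewrite coefD coefZ mulrDl -mulrA.
Qed.

HB.instance Definition _ n :=
  GRing.isLinear.Build rat {poly rat} rat *%R (umbral n) (umbral_is_scalar n).

Lemma umbral_sum_lt n K (p : {poly rat}) : (n < K)%N ->
  umbral n p = \sum_(k < K) p`_k * (stirling2 n k * k`!)%:R.
Proof.
move=> lt_nK; rewrite /umbral.
rewrite (big_ord_widen K (fun k => p`_k * (stirling2 n k * k`!)%:R)) //.
rewrite big_mkcond /=.
apply: eq_bigr => k _; case: ltnP => // le_nk.
by rewrite stirling2_gt // mul0n mulr0.
Qed.

Lemma umbral_Xadd1n n k : umbral n (('X + 1) ^+ k) = (k ^ n)%:R.
Proof.
rewrite /umbral expn_stirling2 natr_sum; apply: eq_bigr => j _.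
have -> : (('X + 1) ^+ k : {poly rat})`_j = 'C(k, j)%:R.
  rewrite exprD1n coef_sum; under eq_bigr do rewrite coefMn coefXn.
  have [le_jk | lt_kj] := leqP j k.
    rewrite (bigD1 (Ordinal (le_jk : j < k.+1)%N)) //= eqxx big1 ?addr0 // => i.
    by rewrite -val_eqE /= eq_sym => /negPf->; rewrite mul0rn.
  rewrite bin_small // big1 // => i _.
  by rewrite gtn_eqF ?mul0rn // (leq_ltn_trans _ lt_kj) // -ltnS.
by rewrite -natrM -bin_ffact mulnCA.
Qed.

(** Both sides are bilinear and the powers of ['X + 1] span, so it suffices to take two such powers,
    with exponents i and j; the claim is then the binomial expansion of (i + j)^n. *)
Lemma umbralM n p q :
  umbral n (p * q) =
    \sum_(i < n.+1) 'C(n, i)%:R * umbral i p * umbral (n - i) q.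
Proof.
have Xadd1_basis p' : exists a : {poly rat},
    p' = \sum_(i < size a) a`_i *: ('X + 1) ^+ i.
  (* Substituting ['X + 1] into p'(X - 1) gives back [p']. *)
  exists (p' \Po ('X - 1)); rewrite -comp_polyE.
  by have := comp_polyXaddC_K p' (-1); rewrite polyCN opprK.
have [a ->] := Xadd1_basis p; have [b ->] := Xadd1_basis q.
have umbralE m (c : {poly rat}) :
    umbral m (\sum_(i < size c) c`_i *: ('X + 1) ^+ i) =
    \sum_(i < size c) c`_i * (i ^ m)%:R.
  rewrite linear_sum; apply: eq_bigr => i _.
  by rewrite linearZ /= umbral_Xadd1n.
under [RHS]eq_bigr => i _.
  rewrite !umbralE -mulrA big_distrlr mulr_sumr /=.
  by under eq_bigr do rewrite mulr_sumr; over.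
rewrite exchange_big big_distrlr linear_sum; apply: eq_bigr => i _ /=.
rewrite exchange_big linear_sum; apply: eq_bigr => j _ /=.
rewrite -scalerAl -scalerAr scalerA -exprD linearZ /= umbral_Xadd1n.
rewrite addnC expnDn natr_sum mulr_sumr; apply: eq_bigr => k _.
rewrite !natrM; ring.
Qed.

Lemma umbralXn_eq0 n m p : (n < m)%N -> umbral n ('X^m * p) = 0.
Proof.
move=> lt_nm; rewrite /umbral big1 // => k _.
by rewrite coefXnM (leq_ltn_trans _ lt_nm) ?mul0r // -ltnS.
Qed.

(** * The multinomial theorem *)

(** This is exp(y_1 T) ... exp(y_r T) = exp((y_1 + ... + y_r) T) in degree [m]; truncating the
    series after degree [K] does not affect degrees up to [K]. *)
Lemma coef_prod_truncated_exp (A : comAlgType rat) (r K m : nat)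
    (y : 'I_r -> A) : (m <= K)%N ->
  (\prod_(j < r) \poly_(k < K.+1) (k`!%:R^-1 *: y j ^+ k))`_m =
    m`!%:R^-1 *: (\sum_(j < r) y j) ^+ m.
Proof.
move: m; apply: (big_rec2 (fun (s : {poly A}) (z : A) => forall m, (m <= K)%N ->
  s`_m = m`!%:R^-1 *: z ^+ m)) => [m _|j s z _ IH m le_mK].
  rewrite coef1 expr0n.
  by case: m => [|m]; rewrite ?fact0 ?invr1 ?scale1r ?scaler0.
rewrite coefM addrC exprDn scaler_sumr; apply: eq_bigr => i _.
have le_im : (i <= m)%N by rewrite -ltnS.
rewrite coef_poly ltnS (leq_trans le_im le_mK) IH; last first.
  exact: leq_trans (leq_subr _ _) le_mK.
rewrite -scalerAl -scalerAr scalerA -scaler_nat scalerA.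
congr (_ *: _); last exact: mulrC.
rewrite -(bin_fact le_im) !natrM.
field.
by rewrite !pnatr_eq0 -!lt0n !fact_gt0 bin_gt0 le_im.
Qed.

(** Compare coefficients of degree [m] after expanding the product of truncated exponentials. A
    tuple with sum [m] has all entries at most [K], so the bound on [N] loses nothing. *)
Lemma multinomial_theorem (A : comAlgType rat) (r K m : nat) (y : 'I_r -> A) :
  (m <= K)%N ->
  (\sum_(j < r) y j) ^+ m =
    \sum_(N : {ffun 'I_r -> 'I_K.+1} | (\sum_(j < r) N j == m)%N)
      multinomial (fun j => N j : nat) *: \prod_(j < r) y j ^+ N j.
Proof.
move=> le_mK.
have fact_neq0 k : (k`!%:R : rat) != 0 by rewrite pnatr_eq0 -lt0n fact_gt0.
apply: (scalerI (invr_neq0 (fact_neq0 m))).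
rewrite -(coef_prod_truncated_exp _ _ _ _ _ le_mK).
under eq_bigr do rewrite poly_def.
rewrite bigA_distr_bigA coef_sum [in RHS]big_mkcond scaler_sumr.
apply: eq_bigr => N _ /=.
rewrite scaler_prod prodrXr coefZ coefXn eq_sym.
case: eqP => [<-|_]; last by rewrite mulr0 scaler0.
rewrite mulr1 scaler_prod scalerA /multinomial mulrA mulVf ?fact_neq0 // mul1r.
by rewrite prodfV.
Qed.

(** * The polynomial P of the header and the recurrence *)

Definition block_poly (r : nat) : {poly rat} := r%:R^-1 *: (('X + 1) ^+ r - 1).

Lemma block_polyE r :
  block_poly r = \sum_(j < r) (r%:R^-1 * 'C(r, j.+1)%:R) *: 'X^(j.+1).
Proof.
rewrite /block_poly exprD1n big_ord_recl bin0 expr0 mulr1n addrC addKr.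
rewrite scaler_sumr; apply: eq_bigr => j _.
by rewrite -scalerA scaler_nat.
Qed.

Lemma umbral_block_poly_exp n r m : (m <= n)%N ->
  umbral n (block_poly r ^+ m) =
    \sum_(N : {ffun 'I_r -> 'I_n.+1} | (\sum_(j < r) N j == m)%N)
      bell_term n (fun j => N j : nat).
Proof.
move=> le_mn; rewrite block_polyE (multinomial_theorem _ _ _ _ _ le_mn).
rewrite linear_sum; apply: eq_bigr => N _.
under eq_bigr do rewrite exprZn -exprM exprMn.
rewrite scaler_prod prodrXr big_split prodrXr /= scalerA linearZ /=.
rewrite -/(weight (fun j => N j : nat)).
set w := weight _.
have -> : umbral n 'X^w = (stirling2 n w * w`!)%:R.
  (* The degree [w] may exceed [n], so the sum is first extended to a range that contains [w]. *)
  have lt_nK : (n < (maxn n w).+1)%N by rewrite ltnS leq_maxl.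
  have lt_wK : (w < (maxn n w).+1)%N by rewrite ltnS leq_maxr.
  rewrite (umbral_sum_lt _ _ _ lt_nK) (bigD1 (Ordinal lt_wK)) //= coefXn eqxx.
  rewrite mul1r big1 ?addr0 // => k.
  by rewrite -val_eqE coefXn => /= /negPf->; rewrite mul0r.
rewrite /bell_term -/w natrM div1r; ring.
Qed.

Lemma umbral_block_poly_exp_eq0 n r m : (n < m)%N ->
  umbral n (block_poly r ^+ m) = 0.
Proof.
move=> lt_nm; rewrite block_polyE.
under eq_bigr do rewrite exprS scalerAr.
by rewrite -mulr_sumr exprMn umbralXn_eq0.
Qed.

Lemma umbral_block_poly n r : (0 < r)%N -> (0 < n)%N ->
  umbral n (block_poly r) = r%:R ^+ (n - 1).
Proof.
move=> r_gt0 n_gt0; rewrite linearZ linearB /=.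
(* The constant 1 is the zeroth power of ['X + 1], so L_n(1) = 0^n, which vanishes for positive
   [n]. *)
rewrite umbral_Xadd1n -(expr0 ('X + 1)) umbral_Xadd1n exp0n //.
rewrite subr0 natrX -{1}(subnK n_gt0) addn1 exprS mulrA.
by rewrite mulVf ?mul1r // pnatr_eq0 -lt0n.
Qed.

(** The free bound [K] allows all the b(n - i, r) of the recurrence to be written as sums over the
    same range of m. *)
Lemma ordered_bell_umbral n r K : (n <= K)%N ->
  ordered_bell n r = \sum_(1 <= m < K.+1) umbral n (block_poly r ^+ m).
Proof.
move=> le_nK.
rewrite (@big_cat_nat _ _ _ n.+1) ?ltnS //=.
rewrite [X in _ + X]big_nat_cond [X in _ + X]big1 ?addr0; last first.
  by move=> m /andP[/andP[lt_nm _] _]; apply: umbral_block_poly_exp_eq0.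
under eq_big_nat => m /andP[_ le_mn] do rewrite umbral_block_poly_exp //.
(* Entries at most [n] may still have a sum above [n]; then the weight exceeds [n] too and the
   Stirling number is 0. *)
rewrite /ordered_bell (bigID (fun N : {ffun 'I_r -> 'I_n.+1} =>
  (\sum_(j < r) N j <= n)%N)) /= addrC big1 ?add0r; last first.
  move=> N /andP[_]; rewrite -ltnNge => lt_nN.
  rewrite /bell_term stirling2_gt ?mul0r //.
  by apply: leq_trans lt_nN _; apply: leq_sum => j _; rewrite leq_pmull.
rewrite big_geq_mkord (partition_big (fun N : {ffun 'I_r -> 'I_n.+1} =>
  inord (\sum_(j < r) N j) : 'I_n.+1) (fun m => (1 <= m)%N)) /=; last first.
  by move=> N /andP[N_gt0 le_Nn]; rewrite inordK.
apply: eq_bigr => m m_gt0; apply: eq_bigl => N; rewrite -val_eqE /=.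
apply/andP/eqP => [[/andP[_ le_Nn]] | eq_Nm].
  by rewrite inordK // => /eqP.
by rewrite inordK eq_Nm // m_gt0 -ltnS ltn_ord.
Qed.

Theorem theorem4p7 (r : nat) (hr : (1 <= r)%N) :
  ordered_bell 1 r = 1 /\
  forall n : nat, (2 <= n)%N ->
    ordered_bell n r =
      r%:R ^+ (n - 1) +
      \sum_(1 <= i < n) 'C(n, i)%:R * r%:R ^+ (i - 1) * ordered_bell (n - i) r.
Proof.
split=> [|n n_ge2].
  by rewrite (ordered_bell_umbral _ _ _ (leqnn 1)) big_nat1 umbral_block_poly.
have n_gt0 := ltnW n_ge2.
rewrite (ordered_bell_umbral _ _ _ (leqnn n)) big_ltn // umbral_block_poly //.
congr (_ + _).
(* In the Leibniz rule for P P^m the terms i = 0 and i = n drop out, because L_0 kills every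
   positive power of P. *)
have step m : (1 <= m)%N -> umbral n (block_poly r ^+ m.+1) =
    \sum_(1 <= i < n) 'C(n, i)%:R * r%:R ^+ (i - 1)
                      * umbral (n - i) (block_poly r ^+ m).
  move=> m_gt0; rewrite exprS umbralM.
  rewrite -(big_mkord xpredT (fun i => 'C(n, i)%:R
    * umbral i (block_poly r) * umbral (n - i) (block_poly r ^+ m))).
  rewrite big_nat_recr // big_ltn //= subnn (umbral_block_poly_exp_eq0 0) //.
  rewrite -[X in umbral 0 X]expr1 (umbral_block_poly_exp_eq0 0) //.
  rewrite mulr0 mul0r add0r mulr0 addr0; apply: eq_big_nat => i /andP[i_gt0 _].
  by rewrite umbral_block_poly.
(* The shift of m leaves the range from 1 to n - 1, which suffices for b(n - i, r) since i is at
   least 1. *)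
rewrite big_add1 /=; under eq_big_nat => m /andP[m_gt0 _] do rewrite step //.
rewrite exchange_big; apply: eq_big_nat => i /andP[i_gt0 lt_in].
rewrite -mulr_sumr (ordered_bell_umbral _ _ n.-1) ?prednK //.
by rewrite -ltnS prednK // ltn_subrL i_gt0.
Qed.
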